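(* Let $\alpha$ be a positive root. If $\mathbb J_\alpha$ is a generalized complex structure of complex type on $\mathfrak u_\alpha$, then for every $B$-transformation $B\in\bigwedge^2\mathfrak u_\alpha^\ast$ $$e^{-B}\,\mathbb J_\alpha\,e^{B}=\mathbb J_\alpha .$$
   Context: Let $\mathfrak g$ be a complex semisimple Lie algebra with Cartan subalgebra $\mathfrak h$, positive roots $\Pi^+$, Cartan–Killing form $\langle\cdot,\cdot\rangle$, $H_\alpha\in\mathfrak h$ with $\alpha=\langle H_\alpha,\cdot\rangle$, and Weyl basis $X_\alpha\in\mathfrak g_\alpha$ ($\langle X_\alpha,X_{-\alpha}\rangle=1$). For $\alpha\in\Pi^+$ put $A_\alpha=X_\alpha-X_{-\alpha}$, $S_\alpha=i(X_\alpha+X_{-\alpha})$ and $\mathfrak u_\alpha=\mathrm{span}_{\mathbb R}\{A_\alpha,S_\alpha\}$. Let $H$ be a fixed regular element of $\mathfrak t=i\,\mathrm{span}_{\mathbb R}\{H_\alpha\}$, $\omega_{b_0}(X,Y)=\langle H,[X,Y]\rangle$, $k_\alpha=\frac{1}{2i\langle H,H_\alpha\rangle}$, and $X^\ast=k_\alpha\omega_{b_0}(X,\cdot)\in\mathfrak u_\alpha^\ast$ for $X\in\mathfrak u_\alpha$; then $(-S_\alpha^\ast,A_\alpha^\ast)$ is the basis of $\mathfrak u_\alpha^\ast$ dual to $(A_\alpha,S_\alpha)$. A (torus-invariant) generalized complex structure of complex type on $\mathfrak u_\alpha$ is one of the two endomorphisms $\pm\mathcal J_0$ of $\mathfrak u_\alpha\oplus\mathfrak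 u_\alpha^\ast$, where in the basis $(A_\alpha,S_\alpha,-S_\alpha^\ast,A_\alpha^\ast)$ $$\mathcal J_0=\begin{pmatrix}0&-1&0&0\\1&0&0&0\\0&0&0&-1\\0&0&1&0\end{pmatrix}.$$ For $B\in\bigwedge^2\mathfrak u_\alpha^\ast$, $e^B(X+\xi)=X+\xi+i_XB$. *)

(* Defs.v *)
From HB Require Import structures.
From mathcomp Require Import all_boot all_order all_algebra.
From mathcomp Require Import reals complex.

Set Implicit Arguments.
Unset Strict Implicit.
Unset Printing Implicit Defensive.

Import GRing.Theory passmx.
Local Open Scope ring_scope.
Local Open Scope complex_scope.

(* A complex vector space regarded as a real one, by restriction of scalars. *)
Definition realified (R : realType) (V : vectType R[i]) : Type := V.

Section Realified.
Variables (R : realType) (V : vectType R[i]).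
Local Notation VR := (realified V).

HB.instance Definition _ := GRing.Zmodule.copy VR V.

Definition realified_scale (a : R) (v : VR) : VR := a%:C *: (v : V).

Fact realified_scaleA a b v :
  realified_scale a (realified_scale b v) = realified_scale (a * b) v.
Proof. by rewrite /realified_scale scalerA -rmorphM. Qed.
Fact realified_scale1 : left_id 1 realified_scale.
Proof. by move=> v; rewrite /realified_scale rmorph1 scale1r. Qed.
Fact realified_scaleDr : right_distributive realified_scale +%R.
Proof. by move=> a u v; rewrite /realified_scale scalerDr. Qed.
Fact realified_scaleDl v :
  {morph realified_scale^~ v : a b / a + b >-> a + b}.
Proof. by move=> a b; rewrite /realified_scale rmorphD scalerDl. Qed.

HB.instance Definition _ := GRing.Zmodule_isLmodule.Build R VR
  realified_scaleA realified_scale1 realified_scaleDr realified_scaleDl.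

Let n := \dim {:V}.

Fact realified_vect_iso : Vector.axiom (n + n) VR.
Proof.
pose e := vbasis {:V}.
have eb : basis_of {:V} e := vbasisP _.
pose f (v : VR) : 'rV[R]_(n + n) :=
  row_mx (map_mx (@complex.Re R) (rVof e (v : V)))
         (map_mx (@complex.Im R) (rVof e (v : V))).
pose g (r : 'rV[R]_(n + n)) : VR :=
  vecof e (\row_j (lsubmx r 0 j +i* rsubmx r 0 j)).
exists f.
  move=> a u v; rewrite /f.
  have -> : rVof e (a *: u + v : V) = a%:C *: rVof e (u : V) + rVof e (v : V).
    exact: (linearP (rVof e)).
  rewrite scale_row_mx add_row_mx; congr row_mx; apply/rowP=> j;
  by rewrite !mxE; case: (coord _ _ u) => x y; case: (coord _ _ v) => x' y';
     rewrite /= mul0r ?subr0 ?addr0.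
exists g => [v | r]; rewrite /f /g.
  rewrite -[RHS](rVofK eb); congr (vecof e _); apply/rowP=> j.
  by rewrite row_mxKl row_mxKr !mxE; case: (coord _ _ _).
rewrite vecofK // -[RHS]hsubmxK; congr row_mx; apply/rowP=> j.
  by rewrite !mxE.
by rewrite !mxE.
Qed.

HB.instance Definition _ := Lmodule_hasFinDim.Build R VR realified_vect_iso.

End Realified.

(* The endomorphism whose matrix in the basis e is M, acting on columns of
   coordinates: the image of e_j is sum_i M i j e_i. *)
Definition mx_endo (K : fieldType) (V : vectType K) n (e : n.-tuple V)
    (M : 'M[K]_n) : 'End(V) :=
  linfun (fun v => \sum_i (\sum_j M i j * coord e j v) *: e`_i).

Definition dualv (K : fieldType) (V : vectType K) : vectType K := 'Hom(V, K^o).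

Section LieAlgebra.
Variables (K : fieldType) (g : vectType K).
(* The bracket is given by its adjoint map: [X, Y] = br X Y and ad X = br X,
   so that bilinearity is carried by the type. *)
Variable br : 'Hom(g, 'End(g)).
Implicit Types (X Y Z : g) (U V I h : {vspace g}).

Definition lie_bracket : Prop :=
  (forall X, br X X = 0) /\
  (forall X Y Z, br X (br Y Z) + br Y (br Z X) + br Z (br X Y) = 0).

Definition killing X Y : K :=
  \tr (mxof (vbasis fullv) (vbasis fullv) (br X \o br Y)%VF).

Definition brv U V : {vspace g} :=
  <<[seq br X Y | X <- vbasis U, Y <- vbasis V]>>%VS.

Definition lie_ideal I : Prop := forall X Y, Y \in I -> br X Y \in I.
Definition lie_solvable I : Prop := exists n, iter n (fun V => brv V V) I = 0%VS.
Definition lie_nilpotent h : Prop := exists n, iter n (brv h) h = 0%VS.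

Definition lie_semisimple : Prop :=
  forall I, lie_ideal I -> lie_solvable I -> I = 0%VS.

Definition cartan_subalgebra h : Prop :=
  [/\ forall X Y, X \in h -> Y \in h -> br X Y \in h,
      lie_nilpotent h &
      forall X, (forall Y, Y \in h -> br X Y \in h) -> X \in h].

Definition in_root_space h (a : dualv (subvs_of h)) X : Prop :=
  forall Y : subvs_of h, br (vsval Y) X = a Y *: X.

Definition is_root h (a : dualv (subvs_of h)) : Prop :=
  a != 0 /\ exists2 X, X != 0 & in_root_space a X.

Definition positive_roots h (Pi : seq (dualv (subvs_of h))) : Prop :=
  [/\ forall a, is_root a <-> (a \in Pi \/ - a \in Pi),
      forall a, a \in Pi -> - a \notin Pi &
      forall a b, a \in Pi -> b \in Pi -> is_root (a + b) -> a + b \in Pi].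

Definition dual_vectors h (Hd : dualv (subvs_of h) -> subvs_of h) : Prop :=
  forall a, is_root a ->
    forall Y : subvs_of h, a Y = killing (vsval (Hd a)) (vsval Y).

End LieAlgebra.

Section WeylBasis.
Variables (R : realType) (g : vectType R[i]) (br : 'Hom(g, 'End(g))).
Variables (h : {vspace g}).
Local Notation hdual := (dualv (subvs_of h)).

(* The structure constants m are normalized to be 0 when a + b is not a root,
   which is why the bracket identity excludes a + b = 0. *)
Definition weyl_basis (Xr : hdual -> g) : Prop :=
  (forall a, is_root br a ->
     in_root_space br a (Xr a) /\ killing br (Xr a) (Xr (- a)) = 1) /\
  exists m : hdual -> hdual -> R,
    forall a b, is_root br a -> is_root br b ->
      [/\ a + b != 0 -> br (Xr a) (Xr b) = (m a b)%:C *: Xr (a + b),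
          ~ is_root br (a + b) -> m a b = 0 &
          m (- a) (- b) = - m a b].

Definition torus (Pi : seq hdual) (Hd : hdual -> subvs_of h) :
    {vspace realified g} :=
  <<[seq ('i *: vsval (Hd a) : realified g) | a <- Pi]>>%VS.

Definition regular_elt (H : subvs_of h) : Prop :=
  forall a, is_root br a -> a H != 0.

Definition Avec (Xr : hdual -> g) (a : hdual) : realified g :=
  Xr a - Xr (- a).
Definition Svec (Xr : hdual -> g) (a : hdual) : realified g :=
  'i *: (Xr a + Xr (- a)).

Definition uspace (Xr : hdual -> g) (a : hdual) : {vspace realified g} :=
  <<[:: Avec Xr a; Svec Xr a]>>%VS.

Definition omega (H : g) (X Y : g) : R[i] := killing br H (br X Y).

Definition kconst (Hd : hdual -> subvs_of h) (H : g) (a : hdual) : R[i] :=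
  (2 * 'i * killing br H (vsval (Hd a)))^-1.

End WeylBasis.

Section GeneralizedComplex.
Variables (R : realType).

Definition gtangent (u : vectType R) : vectType R := (u * dualv u)%type.

(* A 2-form B is encoded by the map X |-> i_X B = B(X, -). *)
Definition twoform (u : vectType R) (B : 'Hom(u, dualv u)) : Prop :=
  forall X, B X X = 0.

Definition expB (u : vectType R) (B : 'Hom(u, dualv u)) : 'End(gtangent u) :=
  linfun (fun p : gtangent u => (p.1, p.2 + B p.1) : gtangent u).

Definition J0mx : 'M[R]_4 :=
  \matrix_(i < 4, j < 4)
    nth 0 (nth [::] [:: [:: 0; -1; 0;  0];
                        [:: 1;  0; 0;  0];
                        [:: 0;  0; 0; -1];
                        [:: 0;  0; 1;  0]] i) j.

Variables (g : vectType R[i]) (br : 'Hom(g, 'End(g))) (h : {vspace g}).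
Local Notation hdual := (dualv (subvs_of h)).
Variables (Hd : hdual -> subvs_of h) (Xr : hdual -> g) (H : g) (a : hdual).
Local Notation u := (subvs_of (uspace Xr a)).

Definition Au : u := vsproj (uspace Xr a) (Avec Xr a).
Definition Su : u := vsproj (uspace Xr a) (Svec Xr a).

(* X^* = k_a omega(X, -); its values on u are real (k_a omega(A, S) = 1), and
   taking real parts only serves to land in R. *)
Definition star (X : u) : dualv u :=
  linfun (fun Y : u => complex.Re
    (kconst br Hd H a * omega br H (vsval X) (vsval Y)) : R^o).

Definition gbasis : 4.-tuple (gtangent u) :=
  [tuple (Au, 0); (Su, 0); (0, - star Su); (0, star Au)].

Definition J0 : 'End(gtangent u) := mx_endo gbasis J0mx.

Definition complex_type (J : 'End(gtangent u)) : Prop := J = J0 \/ J = - J0.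

End GeneralizedComplex.

(* Main.v *)
From HB Require Import structures.
Require Import Defs.
From mathcomp Require Import all_boot all_order all_algebra.
From mathcomp Require Import reals complex.
From mathcomp Require Import ring.

Import GRing.Theory passmx.
Local Open Scope ring_scope.
Local Open Scope complex_scope.

(** Write J0 = j (+) j' on u (+) u^*, where j A = S, j S = - A, and, for the
    basis (A', S') dual to (A, S), j' A' = S', j' S' = - A'.  Then
      e^{-B} J0 e^{B} (X, xi) = (j X, j' xi + j' (B X) - B (j X)),
    so the claim for J0, and by linearity for - J0, is that B, seen as a map
    u -> u^*, intertwines j and j'.  This is where the dimension two enters:
    with b = B(A, S), skew-symmetry forces B A = b S' and B S = - b A', hence
    j' (B A) = - b A' = B S = B (j A) and j' (B S) = - b S' = - B A = B (j S).
    Every 2-form is thus a multiple of the area form of u, which is of type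
    (1,1) for j.

    It remains to know that - S^* and A^* really are the dual basis of (A, S),
    which [star_AuSu] derives from k_a omega(A, S) = 1.  By invariance of the
    Killing form,
      omega(A, S) = 2i <H, [X_a, X_{-a}]> = 2i <[H, X_a], X_{-a}> = 2i a(H),
    and a(H) = <H, H_a> is nonzero because H is regular.  The same identity
    makes A and S independent over the reals, since a pair of functionals takes
    on them the values of a dual basis. *)

(** * Linear maps given by formulas *)

Lemma linfunE {K : fieldType} {V W : vectType K} (f : V -> W) :
  linear f -> linfun f =1 f.
Proof.
move=> flin; pose F : {linear V -> W} :=
  HB.pack f (GRing.isLinear.Build K V W *:%R f flin).
exact: (lfunE F).
Qed.

Lemma mx_endo_free {K : fieldType} {V : vectType K} {n} (e : n.-tuple V)
    (M : 'M[K]_n) (k : 'I_n) :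
  free e -> mx_endo e M e`_k = \sum_i M i k *: e`_i.
Proof.
move=> e_free; rewrite /mx_endo linfunE => [|c x y].
  apply: eq_bigr => i _; congr (_ *: _).
  rewrite (bigD1 k) //= coord_free // eqxx mulr1 big1 ?addr0 // => j jk.
  by rewrite coord_free // eq_sym (negPf jk) mulr0.
rewrite scaler_sumr -big_split; apply: eq_bigr => i _ /=.
rewrite scalerA -scalerDl; congr (_ *: _).
rewrite mulr_sumr -big_split; apply: eq_bigr => j _ /=.
by rewrite linearP mulrDr mulrCA.
Qed.

(** * B-transformations of a plane with a dual basis *)

Section Plane.
Context {R : realType} {u : vectType R}.
Variables (A S : u) (A' S' : dualv u).
Hypotheses (A'A : A' A = 1) (A'S : A' S = 0) (S'A : S' A = 0) (S'S : S' S = 1).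
Hypothesis span_AS : forall X : u, exists x y, X = x *: A + y *: S.

Let e : 4.-tuple (gtangent u) := [tuple (A, 0); (S, 0); (0, A'); (0, S')].

Lemma plane_decomp (X : u) : X = A' X *: A + S' X *: S.
Proof.
have [x [y ->]] := span_AS X.
rewrite !linearD !linearZ /= A'A A'S S'A S'S.
by rewrite /GRing.scale /= !mulr1 !mulr0 addr0 add0r.
Qed.

Lemma dual_plane_decomp (xi : dualv u) : xi = xi A *: A' + xi S *: S'.
Proof.
apply/lfunP => X; rewrite add_lfunE !scale_lfunE {1}(plane_decomp X).
rewrite linearD !linearZ /= /GRing.scale /=.
by rewrite [xi A * _]mulrC [xi S * _]mulrC.
Qed.

(** The coordinates used by [mx_endo] are meaningful only on a free family, so
    the action of J0 cannot be read off its matrix before this is known. *)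
Lemma plane_gbasis_free : free e.
Proof.
apply/freeP => k; rewrite !big_ord_recl big_ord0 /= => ke.
have /= e1 := congr1 fst ke; have /= e2 := congr1 snd ke.
have kA : k ord0 = 0.
  move/(congr1 A'): e1.
  by rewrite !(linearD, linearZ, linear0) /= A'A A'S /GRing.scale /=
    ?(mulr1, mulr0, addr0, add0r) ?linear0.
have kS : k (lift ord0 ord0) = 0.
  move/(congr1 S'): e1.
  by rewrite !(linearD, linearZ, linear0) /= S'A S'S /GRing.scale /=
    ?(mulr1, mulr0, addr0, add0r) ?linear0.
move: e2; rewrite !scaler0 !add0r addr0 => e2.
have kA' := congr1 (fun f : dualv u => f A) e2.
have kS' := congr1 (fun f : dualv u => f S) e2.
move: kA' kS'; rewrite !add_lfunE !scale_lfunE !zero_lfunE A'A A'S S'A S'S.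
rewrite /GRing.scale /= !mulr1 !mulr0 addr0 add0r => kA' kS' i.
by case: i => [[|[|[|[|i]]]] lti] //; [rewrite -kA | rewrite -kS | rewrite -kA'
  | rewrite -kS']; congr (k _); apply: val_inj.
Qed.

Lemma plane_J0E (p : gtangent u) :
  mx_endo e (J0mx R) p =
    (A' p.1 *: S - S' p.1 *: A, p.2 A *: S' - p.2 S *: A').
Proof.
have {1}-> : p = A' p.1 *: e`_0 + S' p.1 *: e`_1 + p.2 A *: e`_2 + p.2 S *: e`_3.
  case: p => X xi; congr pair => /=; rewrite !scaler0 ?addr0 ?add0r.
    exact: plane_decomp.
  exact: dual_plane_decomp.
rewrite !linearD !linearZ /=.
have J0col (k : 'I_4) := mx_endo_free e (J0mx R) k plane_gbasis_free.
have J0A : mx_endo e (J0mx R) e`_0 = e`_1.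
  rewrite (J0col (@Ordinal 4 0 isT)) !big_ord_recl big_ord0 !mxE /=.
  by rewrite !scale0r scale1r !addr0 add0r.
have J0S : mx_endo e (J0mx R) e`_1 = - e`_0.
  rewrite (J0col (@Ordinal 4 1 isT)) !big_ord_recl big_ord0 !mxE /=.
  by rewrite !scale0r scaleN1r !addr0.
have J0A' : mx_endo e (J0mx R) e`_2 = e`_3.
  rewrite (J0col (@Ordinal 4 2 isT)) !big_ord_recl big_ord0 !mxE /=.
  by rewrite !scale0r scale1r !addr0 !add0r.
have J0S' : mx_endo e (J0mx R) e`_3 = - e`_2.
  rewrite (J0col (@Ordinal 4 3 isT)) !big_ord_recl big_ord0 !mxE /=.
  by rewrite !scale0r scaleN1r !addr0 !add0r.
rewrite J0A J0S J0A' J0S' /= !scalerN.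
congr pair => /=; rewrite !scaler0 ?oppr0 ?addr0 ?add0r //.
Qed.

(** Both equations say that B is b A' /\ S' with b = B(A, S): 2-forms on a plane
    make up a line. *)
Lemma plane_twoform (B : 'Hom(u, dualv u)) : twoform B ->
  B A = B A S *: S' /\ B S = - (B A S *: A').
Proof.
move=> B_alt; have BSA : B S A = - B A S.
  apply/eqP; rewrite -addr_eq0 addrC; apply/eqP.
  have := B_alt (A + S).
  by rewrite !linearD /= !add_lfunE !B_alt add0r addr0 addrC.
split; first by rewrite {1}[B A]dual_plane_decomp B_alt scale0r add0r.
by rewrite [LHS]dual_plane_decomp B_alt scale0r addr0 BSA scaleNr.
Qed.

Lemma expBE (B : 'Hom(u, dualv u)) (p : gtangent u) :
  expB B p = (p.1, p.2 + B p.1).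
Proof.
rewrite /expB linfunE // => c [X xi] [Y eta] /=.
rewrite linearP; congr pair => /=.
by rewrite scalerDr addrACA.
Qed.

(** After both sides are expanded, the identity left in the cotangent component
    is the relation j' (B X) = B (j X), evaluated on a vector Y. *)
Lemma plane_J0_conj (B : 'Hom(u, dualv u)) : twoform B ->
  (expB (- B) \o mx_endo e (J0mx R) \o expB B)%VF = mx_endo e (J0mx R).
Proof.
move=> /plane_twoform []; move: (B A S : R) => b BA BS; apply/lfunP => -[X xi].
rewrite !comp_lfunE !expBE !plane_J0E /=; congr pair.
have BE x y : B (x *: A + y *: S) = x *: (b *: S') - y *: (b *: A').
  by rewrite [LHS]linearD ![in LHS]linearZ /= BA BS scalerN.
have BXE := BE (A' X) (S' X); rewrite -plane_decomp in BXE.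
rewrite [A' X *: S - _]addrC -(scaleNr (S' X)) opp_lfunE BE BXE.
apply/lfunP => Y.
rewrite !(add_lfunE, opp_lfunE, scale_lfunE) A'A A'S S'A S'S /GRing.scale /=.
ring.
Qed.

End Plane.

(** * Invariance of the Killing form *)

Section Killing.
Context {K : fieldType} {g : vectType K} (br : 'Hom(g, 'End(g))).

Lemma trace_compC (f f' : 'End(g)) :
  \tr (mxof (vbasis fullv) (vbasis fullv) (f \o f')%VF) =
  \tr (mxof (vbasis fullv) (vbasis fullv) (f' \o f)%VF).
Proof. by rewrite !(mxof_comp _ _ (vbasisP _)) mxtrace_mulC. Qed.

Lemma killingC X Y : killing br X Y = killing br Y X.
Proof. exact: trace_compC. Qed.

Lemma killingDr X Y Z : killing br X (Y + Z) = killing br X Y + killing br X Z.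
Proof. by rewrite /killing linearD /= comp_lfunDr !linearD. Qed.

Lemma killingZr X c Y : killing br X (c *: Y) = c * killing br X Y.
Proof. by rewrite /killing linearZ /= -comp_lfunZr !linearZ. Qed.

Lemma killingZl X c Y : killing br (c *: X) Y = c * killing br X Y.
Proof. by rewrite killingC killingZr killingC. Qed.

Hypothesis br_lie : lie_bracket br.

Lemma lie_anticomm X Y : br X Y = - br Y X.
Proof.
have [alt _] := br_lie; apply/eqP; rewrite -addr_eq0; apply/eqP.
have := alt (X + Y).
by rewrite !linearD /= !add_lfunE !alt add0r addr0 addrC.
Qed.

(** The Jacobi identity, read as an identity between endomorphisms. *)
Lemma ad_bracket X Y : br (br X Y) = (br X \o br Y)%VF - (br Y \o br X)%VF.
Proof.
apply/lfunP => Z; rewrite add_lfunE opp_lfunE !comp_lfunE.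
have [_ jac] := br_lie; have := jac X Y Z.
rewrite (lie_anticomm Z (br X Y)) (lie_anticomm Z X) linearN /=.
by move/eqP; rewrite subr_eq0 => /eqP.
Qed.

(** By [ad_bracket] the two sides are tr(xyz - xzy) and tr(xyz - yxz), which
    agree since the trace is cyclic. *)
Lemma killing_invariant X Y Z :
  killing br X (br Y Z) = killing br (br X Y) Z.
Proof.
rewrite /killing !ad_bracket.
rewrite comp_lfunDl comp_lfunDr comp_lfunNl comp_lfunNr !linearB /=.
by rewrite !comp_lfunA [in LHS](trace_compC (br X \o br Z)) comp_lfunA.
Qed.

End Killing.

(** * The plane spanned by A and S at a root *)

Section WeylPlane.
Context {R : realType} {g : vectType R[i]} {br : 'Hom(g, 'End(g))}
  {h : {vspace g}}.
Hypothesis br_lie : lie_bracket br.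
Context {Hd : dualv (subvs_of h) -> subvs_of h} (Hd_dual : dual_vectors br Hd).
Context {Xr : dualv (subvs_of h) -> g} (Xr_weyl : weyl_basis br Xr).
Variable H : subvs_of h.
Context {a : dualv (subvs_of h)}.
Hypothesis a_root : is_root br a.

Local Notation A := (Avec Xr a).
Local Notation S := (Svec Xr a).

Lemma omega_alt X : omega br (vsval H) X X = 0.
Proof.
have [alt _] := br_lie.
by rewrite /omega alt -(scale0r 0) killingZr mul0r.
Qed.

Lemma omega_anticomm X Y : omega br (vsval H) X Y = - omega br (vsval H) Y X.
Proof.
by rewrite /omega (lie_anticomm _ br_lie) -scaleN1r killingZr mulN1r.
Qed.

(** Since A = X_a - X_{-a} and S = i (X_a + X_{-a}), the bracket [A, S] is
    2i [X_a, X_{-a}]; invariance then moves H onto X_a, where it acts by the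
    scalar a(H), and leaves the factor <X_a, X_{-a}> = 1. *)
Lemma omega_AS : omega br (vsval H) A S = 2 * 'i * a H.
Proof.
have [/(_ a a_root) [Xa XaX] _] := Xr_weyl; have [alt _] := br_lie.
have -> : omega br (vsval H) A S =
  killing br (vsval H) ((2 * 'i) *: br (Xr a) (Xr (- a))).
  rewrite /omega; congr killing.
  rewrite /Avec /Svec linearZ linearB /= add_lfunE opp_lfunE !linearD /= !alt.
  rewrite (lie_anticomm _ br_lie (Xr (- a))) !opprK oppr0 !scaler0 add0r addr0.
  by rewrite -mulr2n -scaler_nat scalerA mulrC.
by rewrite killingZr (killing_invariant _ br_lie) Xa killingZl XaX mulr1.
Qed.

Lemma kconst_omega_AS : a H != 0 ->
  kconst br Hd (vsval H) a * omega br (vsval H) A S = 1.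
Proof.
move=> aH; rewrite omega_AS /kconst killingC -(Hd_dual _ a_root H).
rewrite mulVf // !mulf_neq0 //.
  by rewrite Num.Theory.pnatr_eq0.
exact: Num.Theory.neq0Ci.
Qed.

Local Notation u := (subvs_of (uspace Xr a)).
Local Notation star := (star br Hd (vsval H)).

(** The formula defining X^* mixes the complex Killing form with a real scalar
    action; its real part is linear because the real scalars act on g through
    their embedding in the complex numbers. *)
Lemma starE (X Y : u) :
  star X Y =
  complex.Re (kconst br Hd (vsval H) a * omega br (vsval H) (vsval X) (vsval Y)).
Proof.
rewrite /Defs.star linfunE // => c Y1 Y2; rewrite linearP.
(* Real scaling unfolds to complex scaling by [c%:C]. *)
rewrite -[LHS]/(complex.Re (kconst br Hd (vsval H) a *
  omega br (vsval H) (vsval X) (c%:C *: (vsval Y1 : g) + (vsval Y2 : g)))).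
rewrite /omega linearD linearZ killingDr killingZr mulrDr mulrCA.
move: (_ * killing _ _ (br _ (vsval Y1))) (_ * killing _ _ (br _ (vsval Y2))).
by move=> [x1 y1] [x2 y2]; rewrite /= mul0r subr0.
Qed.

Lemma vsval_Au : vsval (Au Xr a) = A.
Proof. by rewrite vsprojK // memv_span // !inE eqxx. Qed.

Lemma vsval_Su : vsval (Su Xr a) = S.
Proof. by rewrite vsprojK // memv_span // !inE eqxx orbT. Qed.

Lemma span_AuSu (X : u) : exists x y, X = x *: Au Xr a + y *: Su Xr a.
Proof.
have : vsval X \in (<[A]> + <[S]>)%VS.
  by rewrite -(span_seq1 S) -span_cons; apply: subvsP.
case/memv_addP => _ /vlineP [x ->] [_ /vlineP [y ->] XE].
exists x, y; apply: val_inj.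
by rewrite /= XE vsval_Au vsval_Su.
Qed.

(** In other words, - S^* and A^* form the basis dual to (A, S). *)
Lemma star_AuSu : regular_elt br H ->
  [/\ star (Au Xr a) (Au Xr a) = 0, star (Su Xr a) (Su Xr a) = 0,
     star (Au Xr a) (Su Xr a) = 1 & star (Su Xr a) (Au Xr a) = -1].
Proof.
move=> /(_ a a_root) aH; rewrite !starE vsval_Au vsval_Su !omega_alt.
by rewrite (omega_anticomm S) mulrN kconst_omega_AS // mulr0 /=; split.
Qed.

End WeylPlane.

Theorem proposition5p9 (R : realType) (g : vectType R[i])
  (br : 'Hom(g, 'End(g))) (br_lie : lie_bracket br) (g_ss : lie_semisimple br)
  (h : {vspace g}) (h_cartan : cartan_subalgebra br h)
  (Pi : seq (dualv (subvs_of h))) (Pi_pos : positive_roots br Pi)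
  (Hd : dualv (subvs_of h) -> subvs_of h) (Hd_dual : dual_vectors br Hd)
  (Xr : dualv (subvs_of h) -> g) (Xr_weyl : weyl_basis br Xr)
  (H : subvs_of h) (H_torus : (vsval H : realified g) \in torus Pi Hd)
  (H_reg : regular_elt br H)
  (a : dualv (subvs_of h)) (a_pos : a \in Pi)
  (J : 'End(gtangent (subvs_of (uspace Xr a))))
  (J_complex : complex_type br Hd (vsval H) J)
  (B : 'Hom(subvs_of (uspace Xr a), dualv (subvs_of (uspace Xr a))))
  (B_2form : twoform B) :
  (expB (- B) \o J \o expB B)%VF = J.
Proof.
have a_root : is_root br a by have [rootE _ _] := Pi_pos; apply/rootE; left.
have [AA SS AS SA] :=
  star_AuSu br_lie Hd_dual Xr_weyl _ a_root H_reg.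
have J0_fixed : (expB (- B) \o J0 br Hd Xr (vsval H) a \o expB B)%VF =
    J0 br Hd Xr (vsval H) a.
  apply: plane_J0_conj B_2form;
    rewrite ?opp_lfunE ?AA ?SS ?AS ?SA ?oppr0 ?opprK //.
  exact: span_AuSu.
by case: J_complex => ->; rewrite ?comp_lfunNr ?comp_lfunNl J0_fixed.
Qed.
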